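(* If a pair of integers $(m,k)$, $m>0$, with $k\ge 2$ satisfies $$1^k+2^k+\dots+(m-1)^k=m^k,$$ then the rational number $2k/(2m-3)$ is equal to a convergent $p_j/q_j$ of the regular continued fraction of $\log 2$ with $j$ even.
   Context: $\log$ denotes the natural logarithm. If $\log 2=[a_0,a_1,a_2,\dots]$ is the regular continued fraction expansion (so $a_0=0$), the $j$-th convergent is $p_j/q_j=[a_0,a_1,\dots,a_j]$, with indexing starting from $j=0$. *)

(* Defs.v *)
From mathcomp Require Import all_boot all_order all_algebra.
From mathcomp Require Import all_classical all_reals all_analysis.

Set Implicit Arguments.
Unset Strict Implicit.
Unset Printing Implicit Defensive.

Import Order.TTheory GRing.Theory Num.Theory.

Local Open Scope ring_scope.

(* The finite continued fraction [a, s_0, s_1, ...] = a + 1/(s_0 + 1/(...)). *)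
Fixpoint cfrac_eval (a : int) (s : seq int) : rat :=
  if s is b :: s' then a%:~R + (cfrac_eval b s')^-1 else a%:~R.

Section RegularContinuedFraction.
Variables (R : realType) (x : R).

(* When [complete_quotient j] is an integer the expansion of [x] stops at index
   [j]; the values at larger indices are then junk, since 0^-1 = 0. *)
Fixpoint complete_quotient (j : nat) : R :=
  if j is j'.+1 then
    (complete_quotient j' - (Num.floor (complete_quotient j'))%:~R)^-1
  else x.

Definition partial_quotient (j : nat) : int := Num.floor (complete_quotient j).

(* The first clause says that the expansion of [x] does reach index [j]; it holds
   for every [j] when [x] is irrational. *)
Definition is_convergent (j : nat) (r : rat) : Prop :=
  (forall i : nat, (i < j)%N -> complete_quotient i \isn't a Num.int) /\
  r = cfrac_eval (partial_quotient 0)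
        [seq partial_quotient i | i <- iota 1 j].

End RegularContinuedFraction.

(* Main.v *)
(** With [x = 1/m] the equation reads [sum_(0 < j < m) (1 - j x)^k = 1].  Let
    [L = ln 2].  Replacing [k] by the exponent [K = L (m - 3/2)] and expanding in
    powers of [x], the left-hand side becomes
      [1 + (6 L^2 - 25/6 L) x^2 + O(x^3)],
    whose second coefficient is about [- 0.0054].  So the sum is slightly below 1
    at [K], while decreasing the exponent by [1 / (4 (2m - 3))] raises it by at
    least [0.06 x^2].  As the sum decreases with the exponent,
      [K - 1 / (4 (2m - 3)) < k < K],
    that is [0 < L - 2k/(2m-3) < 1 / (2 (2m-3)^2)].  By Legendre's criterion
    [2k/(2m-3)] is a convergent, of even index because it lies below [L].
    The error terms are harmless for [m > 2^16].  Smaller [m] are excluded by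
    Moser's congruences: a prime [p] dividing [m - 1] divides [(m-1)/p + 1], and an
    odd prime [p] dividing [m + 1] divides [(m+1)/p + 2]. *)
Require Import Defs.
From Stdlib Require Import NArith.
From mathcomp Require Import all_boot all_order all_algebra.
From mathcomp Require Import all_classical all_reals all_analysis.
From mathcomp Require Import zify ring lra.

Import Order.TTheory GRing.Theory Num.Theory.
Import numFieldNormedType.Exports.

Local Open Scope ring_scope.

(** * Continued fractions *)

(** The definition recurses at the far end of the expansion. Peeling off the first partial quotient
    instead matches one Euclidean step. *)
Lemma complete_quotientS (R : realType) (x : R) (j : nat) :
  complete_quotient x j.+1 =
  complete_quotient (x - (Num.floor x)%:~R)^-1 j.
Proof. by elim: j => [|j IHj] //=; rewrite -IHj. Qed.

Lemma is_convergent0 (R : realType) (x : R) (b : int) :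
  b%:~R <= x -> x < (b + 1)%:~R -> is_convergent x 0 b%:~R.
Proof.
move=> bx xb; split=> //=; rewrite /partial_quotient /=.
by rewrite (@floor_def _ x b) // bx xb.
Qed.

(** The strict inequality [b < x] matters: it makes [x] a non-integer, so the expansion does
    continue past index 0. *)
Lemma is_convergentS (R : realType) (x : R) (b : int) (j : nat) (r : rat) :
  b%:~R < x -> x < (b + 1)%:~R -> is_convergent (x - b%:~R)^-1 j r ->
  is_convergent x j.+1 (b%:~R + r^-1).
Proof.
move=> bx xb [Hn Hr].
have Ef : Num.floor x = b by apply: floor_def; rewrite ltW.
split.
  case=> [_|i ij].
    rewrite /= intrEfloor Ef.
    by apply/negP => /eqP E; move: bx; rewrite E ltxx.
  by rewrite complete_quotientS Ef; apply: Hn.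
rewrite Hr /= /partial_quotient [complete_quotient x 0]/= Ef.
congr (_ + (cfrac_eval _ _)^-1).
  by rewrite complete_quotientS Ef.
rewrite (iotaDl 1 1) -map_comp; apply: eq_map => i.
by rewrite -[RHS]/(Num.floor (complete_quotient x i.+1)) complete_quotientS Ef.
Qed.

Lemma mulz_neq1 (a q : int) : 1 < q -> a * q <> 1.
Proof. by move=> q1; case: (lerP a 0) => a0; nia. Qed.

(* One Euclidean step [p = b q + r], [p' = b q' + r'] maps the interval with
   endpoints [p / q] and [(p + p') / (q + q')] to the one with endpoints
   [q / r] and [(q + q') / (r + r')], and exchanges the two parities. *)
Lemma convergent_of_neighbours (R : realType) (n : nat) :
  (forall (x : R) (p q p' q' : int), (0 < q <= n%:Z) -> 0 <= q' <= q ->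
    p' * q - p * q' = 1 ->
    p%:~R < x * q%:~R -> x * (q + q')%:~R < (p + p')%:~R ->
    exists j, ~~ odd j /\ is_convergent x j (p%:~R / q%:~R)) /\
  (forall (x : R) (p q p' q' : int), (0 < q <= n%:Z) -> 0 < q' <= q ->
    p * q' - p' * q = 1 ->
    x * q%:~R < p%:~R -> (p + p')%:~R < x * (q + q')%:~R ->
    exists j, odd j /\ is_convergent x j (p%:~R / q%:~R)).
Proof.
elim: n => [|n [IHe IHo]].
  by split=> x p q p' q' /andP[q0 qn]; exfalso; lia.
have step (x : R) (b q r : int) : 0 < q -> 0 < r ->
    (b * q + r)%:~R / q%:~R = b%:~R + (q%:~R / r%:~R)^-1 :> rat.
  move=> q0 r0; rewrite intrD intrM mulrDl mulfK ?invf_div //.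
  by rewrite intr_eq0; lia.
split=> x p q p' q' /andP[q0 qn] /andP[q'0 q'q] det.
(* For [q = 1] the second endpoint is [p + 1] (if [q' = 0]) or [p + 1/2] (if [q' = 1]), so in both
   cases [p] is the floor of [x], the convergent of index 0. *)
- have [q1|q1] : q = 1 \/ 1 < q by lia.
    subst q => xl xr; exists 0%N; split=> //; rewrite divr1.
    rewrite mulr1 in xl; apply: is_convergent0; first exact: ltW.
    have [q'E|q'E] : q' = 0 \/ q' = 1 by lia.
      subst q'; move: xr; rewrite addr0 mulr1.
      by have -> : p' = 1 by lia.
    subst q'; have p'E : p' = p + 1 by lia.
    subst p'; move: xr xl; rewrite !intrD; lra.
  (* Each of [q' = 0], [q' = q] and, below, [r = 0] would make [q > 1] divide the determinant 1. *)
  have q'1 : 0 < q'.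
    rewrite lt_neqAle q'0 andbT; apply/eqP => q'E.
    by move: det; rewrite -q'E mulr0 subr0; apply: mulz_neq1.
  have q'2 : q' < q.
    rewrite lt_neqAle q'q andbT; apply/eqP => q'E.
    by move: det; rewrite q'E -mulrBl; apply: mulz_neq1.
  pose b := (p %/ q)%Z; pose r := (p %% q)%Z.
  have pE : p = b * q + r by apply: divz_eq.
  have rge0 : 0 <= r by apply: modz_ge0; lia.
  have rq : r < q by apply: ltz_pmod.
  have r0 : 0 < r.
    rewrite lt_neqAle rge0 andbT; apply/eqP => rE.
    move: det; rewrite pE -rE addr0.
    have -> : p' * q - b * q * q' = (p' - b * q') * q by ring.
    exact: mulz_neq1.
  pose r' := p' - b * q'.
  have p'E : p' = b * q' + r' by rewrite /r'; ring.
  have det' : q * r' - q' * r = 1 by rewrite -det pE p'E; ring.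
  have r'1 : 0 < r' by nia.
  have r'r : r' <= r by nia.
  have r'q : r' <= q' by nia.
  clearbody b r r'; clear det rge0; subst p p' => xl xr.
  have bx : b%:~R < x.
    rewrite -(ltr_pM2r (_ : 0 < q%:~R)) ?ltr0z //; apply: lt_trans xl.
    by rewrite -intrM ltr_int; lia.
  have xb : x < (b + 1)%:~R.
    rewrite -(ltr_pM2r (_ : 0 < (q + q')%:~R)) ?ltr0z; last by lia.
    by apply: (lt_trans xr); rewrite -intrM ltr_int; lia.
  have x0 : 0 < x - b%:~R by rewrite subr_gt0.
  have [|||||j [jo cj]] := IHo (x - b%:~R)^-1 q r q' r'.
  + lia.
  + lia.
  + by lia.
  + rewrite mulrC ltr_pdivrMr //; move: xl; rewrite intrD intrM; lra.
  + rewrite [X in _ < X]mulrC ltr_pdivlMr //.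
    move: xr; rewrite !intrD !intrM; lra.
  exists j.+1; split; first by rewrite /= negbK.
  by rewrite step //; apply: is_convergentS.
have [q1|q1] : q = 1 \/ 1 < q by lia.
  subst q; have q'E : q' = 1 by lia.
  subst q'; have pE : p = p' + 1 by lia.
  subst p => xl xr; rewrite mulr1 in xl.
  (* Here [p' + 1/2 < x < p' + 1], so the expansion begins [[p', 1, ...]]. The integer [p' + 1]
     above [x] is thus the convergent of index 1. *)
  exists 1%N; split=> //; rewrite divr1.
  have bx : p'%:~R < x by move: xl xr; rewrite !intrD; lra.
  have -> : (p' + 1)%:~R = p'%:~R + (1%:~R)^-1 :> rat by rewrite intrD invr1.
  have x0 : 0 < x - p'%:~R by rewrite subr_gt0.
  apply: is_convergentS => //; apply: is_convergent0.
    by rewrite -[X in X <= _]invr1 lef_pV2 ?posrE //; move: xl; rewrite intrD; lra.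
  rewrite -[X in X < _]mul1r ltr_pdivrMr //.
  by move: xr; rewrite !intrD; lra.
have q'2 : q' < q.
  rewrite lt_neqAle q'q andbT; apply/eqP => q'E.
  by move: det; rewrite q'E -mulrBl; apply: mulz_neq1.
pose b := (p %/ q)%Z; pose r := (p %% q)%Z.
have pE : p = b * q + r by apply: divz_eq.
have rge0 : 0 <= r by apply: modz_ge0; lia.
have rq : r < q by apply: ltz_pmod.
have r0 : 0 < r.
  rewrite lt_neqAle rge0 andbT; apply/eqP => rE.
  move: det; rewrite pE -rE addr0.
  have -> : b * q * q' - p' * q = (b * q' - p') * q by ring.
  exact: mulz_neq1.
pose r' := p' - b * q'.
have p'E : p' = b * q' + r' by rewrite /r'; ring.
have det' : q' * r - q * r' = 1 by rewrite -det pE p'E; ring.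
have r'1 : 0 <= r' by nia.
have r'r : r' < r by nia.
clearbody b r r'; clear det rge0; subst p p' => xl xr.
have bx : b%:~R < x.
  rewrite -(ltr_pM2r (_ : 0 < (q + q')%:~R)) ?ltr0z; last by lia.
  by apply: lt_trans xr; rewrite -intrM ltr_int; lia.
have xb : x < (b + 1)%:~R.
  rewrite -(ltr_pM2r (_ : 0 < q%:~R)) ?ltr0z //.
  by apply: (lt_trans xl); rewrite -intrM ltr_int; lia.
have x0 : 0 < x - b%:~R by rewrite subr_gt0.
have [|||||j [jo cj]] := IHe (x - b%:~R)^-1 q r q' r'.
+ lia.
+ lia.
+ by lia.
+ rewrite [X in _ < X]mulrC ltr_pdivlMr //; move: xl; rewrite intrD intrM; lra.
+ rewrite mulrC ltr_pdivrMr //.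
  move: xr; rewrite !intrD !intrM; lra.
exists j.+1; split; first by rewrite /= jo.
by rewrite step //; apply: is_convergentS.
Qed.

(** Legendre's criterion from below. Bezout completes [r = p / q] to a pair [p / q], [p' / q'] of
    determinant 1 with [0 <= q' < q]. The mediant exceeds [r] by [1 / (q (q + q'))], which is more
    than [1 / (2 d^2)], so [x] lies between [r] and the mediant. Taking any [d] at least the
    denominator allows fractions that are not in lowest terms. *)
Lemma legendre_even_convergent (R : realType) (x : R) (r : rat) (d : int) :
  0 < d -> denq r <= d -> ratr r < x -> (x - ratr r) * (2 * d%:~R ^+ 2) <= 1 ->
  exists j, ~~ odd j /\ is_convergent x j r.
Proof.
move=> d0 rd rx xr.
set p := numq r; set q := denq r.
have q0 : 0 < q := denq_gt0 r.
have [[u v] /= uv] : exists uv : int * int, uv.1 * p + uv.2 * q = 1.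
  by apply/coprimezP; rewrite coprimezE coprime_num_den.
pose q' := (- u %% q)%Z; pose c := (- u %/ q)%Z.
have uE : - u = c * q + q' by apply: divz_eq.
have q'0 : 0 <= q' by apply: modz_ge0; lia.
have q'q : q' < q by apply: ltz_pmod.
have qR0 : 0 < (q%:~R : R) by rewrite ltr0z.
have rE : ratr r * q%:~R = p%:~R :> R by rewrite /ratr mulfVK ?gt_eqF.
have det : (v - p * c) * q - p * q' = 1.
  rewrite -uv; have -> : u = - (c * q + q') by rewrite -uE opprK.
  by ring.
have xq : p%:~R < x * q%:~R by rewrite -rE ltr_pM2r.
have xqq : x * (q + q')%:~R < (p + (v - p * c))%:~R.
  rewrite -(ltr_pM2r qR0) -[X in _ < X]intrM.
  have -> : (p + (v - p * c)) * q = p * (q + q') + 1 by rewrite -det; ring.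
  rewrite [in X in _ < X]intrD intrM -rE.
  set e := x - ratr r in xr; have e0 : 0 < e by rewrite subr_gt0.
  have -> : x = ratr r + e by rewrite /e; ring.
  have h1 : (q%:~R : R) <= d%:~R by rewrite ler_int.
  have h2 : ((q + q')%:~R : R) + 1 <= 2 * q%:~R.
    by rewrite -[1]/(1%:~R) -[2]/(2%:~R) -intrM -intrD ler_int; lia.
  have h3 : (q + q')%:~R * q%:~R < 2 * (d%:~R : R) ^+ 2.
    have : 0 <= ((q + q')%:~R : R) by rewrite ler0z; lia.
    nra.
  have h4 : e * ((q + q')%:~R * q%:~R) < e * (2 * d%:~R ^+ 2) by rewrite ltr_pM2l.
  lra.
have [+ _] := convergent_of_neighbours R `|q|%N.
move=> /(_ x p q (v - p * c) q').
have -> : p%:~R / q%:~R = r by rewrite divq_num_den.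
by apply=> //; lia.
Qed.

(** * Congruences and small solutions *)

(** If some nonzero [a] has [a^k != 1], multiplication by [a] permutes the field and scales the sum
    by [a^k], so the sum vanishes. Otherwise it consists of [p - 1] ones. This dichotomy avoids
    primitive roots. *)
Lemma Fp_power_sum (p k : nat) : prime p -> (0 < k)%N ->
  (forall a : 'F_p, a != 0 -> a ^+ k = 1) /\ \sum_(a : 'F_p) a ^+ k = -1 \/
  \sum_(a : 'F_p) a ^+ k = 0.
Proof.
move=> pp k0.
have [/forallP H|] := boolP [forall a : 'F_p, (a != 0) ==> (a ^+ k == 1)].
  left; have H1 (a : 'F_p) : a != 0 -> a ^+ k = 1.
    by move=> a0; apply/eqP; move: (H a); rewrite a0.
  split=> //; rewrite (bigD1 0) //= expr0n gtn_eqF // add0r.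
  rewrite (eq_bigr (fun=> 1)); last by move=> a /H1.
  rewrite sumr_const cardC1 card_Fp //; apply/eqP.
  by rewrite -subr_eq0 opprK -mulrSr prednK ?prime_gt0 // pchar_Fp_0.
rewrite negb_forall => /existsP[a]; rewrite negb_imply => /andP[a0 ak].
right; have : \sum_(b : 'F_p) b ^+ k = a ^+ k * \sum_(b : 'F_p) b ^+ k.
  rewrite mulr_sumr (reindex_inj (mulfI a0)); apply: eq_bigr => b _.
  by rewrite exprMn.
move/eqP; rewrite -subr_eq0 -{1}[X in X - _]mul1r -mulrBl mulf_eq0.
by rewrite subr_eq0 eq_sym (negPf ak) => /eqP.
Qed.

Lemma sum_Fp (p t k : nat) : prime p ->
  \sum_(0 <= i < p * t) (i%:R : 'F_p) ^+ k = t%:R * \sum_(a : 'F_p) a ^+ k.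
Proof.
move=> pp; have ppos := prime_gt0 pp.
have S1 : \sum_(0 <= i < p) (i%:R : 'F_p) ^+ k = \sum_(a : 'F_p) a ^+ k.
  rewrite -[X in \sum_(0 <= i < X) _](Fp_cast pp) big_mkord.
  by apply: eq_bigr => a _; rewrite natr_Zp.
elim: t => [|t IH]; first by rewrite muln0 big_geq // mul0r.
rewrite mulnS addnC (big_cat_nat (n := p * t)) ?leq_addr //= IH.
rewrite -[X in \sum_(X <= i < _) _]add0n big_addn addKn.
rewrite [X in _ + X](_ : _ = \sum_(a : 'F_p) a ^+ k).
  by rewrite [in RHS]mulrSr mulrDl mul1r.
rewrite -S1; apply: eq_bigr => i _.
by rewrite natrD natrM pchar_Fp_0 // mul0r addr0.
Qed.

(** * Binary certificates for the exclusion of small moduli *)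

Lemma N_divmod (n p : nat) : (0 < p)%N ->
  N.of_nat (n %/ p) = N.div (N.of_nat n) (N.of_nat p) /\
  N.of_nat (n %% p) = N.modulo (N.of_nat n) (N.of_nat p).
Proof.
move=> p0; have np := ltn_pmod n p0; have nE := divn_eq n p.
have h1 : N.lt (N.of_nat (n %% p)) (N.of_nat p) by lia.
have h2 : N.of_nat n =
    N.add (N.mul (N.of_nat p) (N.of_nat (n %/ p))) (N.of_nat (n %% p)).
  by rewrite -Nnat.Nat2N.inj_mul -Nnat.Nat2N.inj_add; congr N.of_nat; lia.
by split; [apply: N.div_unique h1 h2 | apply: N.mod_unique h1 h2].
Qed.

Lemma N_dvd (n p : nat) : (0 < p)%N ->
  N.eqb (N.modulo (N.of_nat n) (N.of_nat p)) 0 = (p %| n)%N.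
Proof.
by move=> p0; rewrite -(proj2 (N_divmod n p p0)) /dvdn; case: (n %% p)%N.
Qed.

Lemma N_div (n p : nat) : (0 < p)%N ->
  N.of_nat (n %/ p) = N.div (N.of_nat n) (N.of_nat p).
Proof. by move=> p0; case: (N_divmod n p p0). Qed.

(* [excluded ps n n] certifies that [m = n + 1] violates one of the two
   congruences for some prime in [ps], or that [n] has a prime factor outside
   [ps]; [r] is what remains of [n] once the primes already met are divided out. *)
Fixpoint excluded (ps : seq BinNums.N) (n r : BinNums.N) : bool :=
  if ps is p :: ps' then
    if N.eqb (N.modulo r p) 0 then
      if N.eqb (N.modulo (N.succ (N.div n p)) p) 0 then excluded ps' n (N.div r p)
      else true
    else if N.eqb (N.modulo (N.add n 2) p) 0 then
      if N.eqb (N.modulo (N.add (N.div (N.add n 2) p) 2) p) 0 then excluded ps' n r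
      else if N.eqb p 2 then excluded ps' n r else true
    else excluded ps' n r
  else ~~ N.eqb r 1.

(** A binary tree of depth [d] whose leaves are the numbers from [a 2^d] to [(a + 1) 2^d - 1]. The
    values below 3 and the value 6, that is [m = 1, 2, 3, 7], are left aside for a direct
    treatment. *)
Fixpoint excluded_block (ps : seq BinNums.N) (d : nat) (a : BinNums.N) : bool :=
  if d is d'.+1 then
    if excluded_block ps d' (N.double a) then excluded_block ps d' (N.succ_double a)
    else false
  else if N.ltb a 3 then true else if N.eqb a 6 then true else excluded ps a a.

(** * Moser's congruences for a solution and the lower bound on the modulus *)

Section ErdosMoser.
Variables (m k : nat).
Hypothesis hk : (0 < k)%N.
Hypothesis hmk : (\sum_(1 <= i < m) i ^ k = m ^ k)%N.

Lemma erdos_moser_Fp (p : nat) : (0 < m)%N ->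
  \sum_(0 <= i < m) (i%:R : 'F_p) ^+ k = m%:R ^+ k.
Proof.
move=> m0; rewrite big_ltn // expr0n gtn_eqF // add0r -natrX -hmk natr_sum.
by apply: eq_bigr => i _; rewrite natrX.
Qed.

Lemma dvdn_Fp (p n : nat) : prime p -> (n%:R == 0 :> 'F_p) = (p %| n)%N.
Proof. by move=> pp; rewrite -(dvdn_pcharf (pchar_Fp pp)). Qed.

(** Modulo [p] the numbers below [m] cover every residue [t] times, plus one extra 0, while
    [m^k = 1]. So [t] times the full power sum is 1; that sum must then be -1, which gives [t = -1].
    It also forces [(-1)^k = 1], hence the parity of [k] when [p] is odd. *)
Lemma erdos_moser_pred (p t : nat) : prime p -> m = (p * t).+1 ->
  (p %| t.+1)%N /\ (odd p -> ~~ odd k).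
Proof.
move=> pp mE; have := erdos_moser_Fp p; rewrite mE => /(_ isT).
rewrite big_nat_recr //= sum_Fp // mulrS natrM pchar_Fp_0 // mul0r addr0.
rewrite expr0n gtn_eqF // addr0 expr1n.
case: (Fp_power_sum _ _ pp hk) => [[H ->]|->]; last first.
  by rewrite mulr0 => /esym/eqP; rewrite oner_eq0.
rewrite mulrN1 => tE; split.
  have tN : (t%:R : 'F_p) = -1 by apply: oppr_inj; rewrite opprK.
  by rewrite -dvdn_Fp // mulrSr tN addNr.
move=> op; have := H (-1); rewrite oppr_eq0 oner_eq0 => /(_ isT).
rewrite -signr_odd; case: (odd k) => // /eqP; rewrite expr1 -subr_eq0 -opprD oppr_eq0.
rewrite -[1 + 1]/(2%:R) dvdn_Fp // => /dvdn_leq => /(_ isT).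
by have := prime_gt1 pp; case: p op {pp mE tE H} => [|[|[|]]].
Qed.

(** Adding the term [m^k] completes the residues to [t] full cycles, so [t] times the full power sum
    is [2 m^k]. With [m = -1] and [p] odd this is nonzero, so the full sum is -1, [m^k = 1] and
    [t = -2]. *)
Lemma erdos_moser_succ (p t : nat) : prime p -> odd p -> m.+1 = (p * t)%N ->
  (p %| t.+2)%N.
Proof.
move=> pp op mE.
have m0 : (0 < m)%N.
  by case: m mE => // /esym /eqP; rewrite muln_eq1 => /andP[/eqP p1]; rewrite p1 in pp.
have := sum_Fp p t k pp; rewrite -mE big_nat_recr //= erdos_moser_Fp //.
have mN : (m%:R : 'F_p) = -1.
  by apply/eqP; rewrite -subr_eq0 opprK -mulrSr mE natrM pchar_Fp_0 ?mul0r.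
have p2 : (2%:R : 'F_p) != 0.
  rewrite dvdn_Fp //; apply/negP => /dvdn_leq => /(_ isT).
  by have := prime_gt1 pp; case: p op {pp mE mN} => [|[|[|]]].
have N0 : (m%:R : 'F_p) != 0 by rewrite mN oppr_eq0 oner_eq0.
case: (Fp_power_sum _ _ pp hk) => [[H ->]|->]; last first.
  rewrite mulr0 -mulr2n -[X in X = _]mulr_natr => /eqP.
  by rewrite mulf_eq0 (negPf p2) orbF expf_eq0 (negPf N0) andbF.
rewrite H // mulrN1 => tE.
have tN : (t%:R : 'F_p) = - (1 + 1) by apply: oppr_inj; rewrite opprK.
by rewrite -dvdn_Fp // 2!mulrSr tN -addrA addNr.
Qed.

(** The invariant is that every prime factor of [r] still occurs in the remaining list. When the
    list is exhausted, [r] is therefore 1. *)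
Lemma excluded_sound (qs : seq nat) (n r : nat) : (0 < n)%N -> m = n.+1 ->
  all prime qs -> (r %| n)%N ->
  (forall p, prime p -> p %| r -> p \in qs)%N ->
  ~~ excluded (map N.of_nat qs) (N.of_nat n) (N.of_nat r).
Proof.
move=> n0 mE; elim: qs r => [|p qs IH] r /=.
  move=> _ rn H; rewrite negbK; suff -> : r = 1%N by [].
  apply/eqP/negPn/negP => r1.
  have r2 : (1 < r)%N by have := dvdn_gt0 n0 rn; lia.
  by have := H _ (pdiv_prime r2) (pdiv_dvd r).
move=> /andP[pp qsp] rn H.
have p0 := prime_gt0 pp.
rewrite N_dvd //; case: ifPn => [pr|npr].
  have pn : (p %| n)%N := dvdn_trans pr rn.
  have nE : n = (p * (n %/ p))%N by rewrite mulnC divnK.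
  have [pt _] := erdos_moser_pred _ _ pp (etrans mE (congr1 S nE)).
  rewrite -!N_div // -Nnat.Nat2N.inj_succ N_dvd // pt.
  apply: IH => //; first by apply: dvdn_trans rn; rewrite dvdn_div.
  move=> q qp qr; have := H q qp (dvdn_trans qr (dvdn_div pr)).
  rewrite in_cons => /predU1P[qE|//]; exfalso; subst q.
  (* One division removes [p] entirely: [p] divides [n / p + 1], so it cannot divide [n / p]. *)
  have : (p %| n %/ p)%N.
    by apply: dvdn_trans qr _; rewrite dvdn_divRL // divnK.
  by move=> /(dvdn_addr 1); rewrite addn1 pt dvdn1 => /esym /eqP pE; rewrite pE in pp.
have IHr : ~~ excluded [seq N.of_nat i | i <- qs] (N.of_nat n) (N.of_nat r).
  apply: IH => // q qp qr; have := H q qp qr.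
  by rewrite in_cons => /predU1P[qE|//]; subst q; rewrite qr in npr.
have -> : N.add (N.of_nat n) 2 = N.of_nat n.+2 by lia.
rewrite N_dvd //; case: ifPn => // pn.
rewrite -N_div //.
have -> : N.add (N.of_nat (n.+2 %/ p)) 2 = N.of_nat (n.+2 %/ p).+2 by lia.
rewrite N_dvd //; case: ifPn => // npt.
have [pE|p2] := N.eqb_spec (N.of_nat p) 2; first by [].
have op : odd p by case/even_prime: pp => // pE; case: p2; rewrite pE.
have nE : m.+1 = (p * (n.+2 %/ p))%N by rewrite mulnC divnK // mE.
by rewrite (erdos_moser_succ _ _ pp op nE) in npt.
Qed.

(** The primes below 257 suffice up to [2^16]: a prime [p] dividing [n = m - 1] divides [n / p + 1],
    so [p >= 257] would give [n >= 257 * 256 > 2^16]. *)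
Definition small_primes : seq nat := [seq p <- iota 2 255 | prime p].

Lemma excluded_block_sound (qs : seq BinNums.N) (d n : nat) (a : BinNums.N) :
  excluded_block qs d a -> (N.to_nat a * 2 ^ d <= n < (N.to_nat a).+1 * 2 ^ d)%N ->
  [|| (n < 3)%N, n == 6 | excluded qs (N.of_nat n) (N.of_nat n)].
Proof.
elim: d a => [|d IH] a /=.
  rewrite expn0 !muln1 => H an.
  have -> : n = N.to_nat a by lia.
  rewrite Nnat.N2Nat.id; move: H.
  case: N.ltb_spec => [? _|_]; first by have -> : (N.to_nat a < 3)%N by lia.
  case: N.eqb_spec => [-> _|_ ->]; first by rewrite orbT.
  by rewrite !orbT.
case: ifP => // Ha Hb an; rewrite expnS in an.
have [lt|ge] := ltnP n ((N.to_nat a).*2.+1 * 2 ^ d).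
  apply: (IH _ Ha); rewrite (_ : N.to_nat (N.double a) = (N.to_nat a).*2); last by lia.
  by rewrite lt andbT -muln2 -mulnA; case/andP: an.
apply: (IH _ Hb).
rewrite (_ : N.to_nat (N.succ_double a) = (N.to_nat a).*2.+1); last by lia.
by rewrite ge /= -doubleS -muln2 -mulnA; case/andP: an.
Qed.

Lemma small_modulus_excluded : excluded_block (map N.of_nat small_primes) 16 0.
Proof. by vm_compute. Qed.

Lemma erdos_moser_gt : (0 < m)%N -> (2 <= k)%N -> (2 ^ 16 < m)%N.
Proof.
move=> m0 k2; rewrite ltnNge; apply/negP => m16.
have [n mE] : exists n, m = n.+1 by exists m.-1; rewrite prednK.
have := excluded_block_sound _ _ n _ small_modulus_excluded.
have -> : (N.to_nat 0 * 2 ^ 16 <= n < (N.to_nat 0).+1 * 2 ^ 16)%N.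
  by rewrite -[N.to_nat 0]/0%N mul0n mul1n leq0n -mE.
move=> /(_ isT) /or3P[n3|/eqP n6|]; last first.
- have n0 : (0 < n)%N by rewrite lt0n; apply: contraTneq isT => nE; move: hmk;
    rewrite mE nE big_geq // exp1n.
  apply/negP; apply: excluded_sound => [//|//|||]; [exact: filter_all|exact: dvdnn|].
  move=> p pp pn; rewrite mem_filter pp mem_iota prime_gt1 //=.
  rewrite addSn ltnS leqNgt; apply/negP => p256.
  have nE : n = (p * (n %/ p))%N by rewrite mulnC divnK.
  have [/dvdn_leq pt _] := erdos_moser_pred _ _ pp (etrans mE (congr1 S nE)).
  have {}pt := pt isT.
  have : (257 * 256 <= n)%N by rewrite nE leq_mul // -ltnS (leq_trans _ pt).
  rewrite leqNgt => /negP; apply; apply: leq_ltn_trans (_ : (2 ^ 16 < _)%N) => //.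
  by rewrite -ltnS -mE ltnW // ltnS.
(* The case [m = 7] passes both congruences. The prime 3 makes [k] even; then modulo 4 the left side
   is 3 and [7^k] is 1. *)
- have [_ /(_ isT) ek] : (3 %| 3)%N /\ (odd 3 -> ~~ odd k).
    by apply: erdos_moser_pred => //; rewrite mE n6.
  have H i : (i ^ k %% 4 = (i ^ 2 %% 4) ^ k./2 %% 4)%N.
    by rewrite modnXm -expnM; congr (_ ^ _ %% _)%N; lia.
  have k20 : (0 < k./2)%N by lia.
  have := (H 2, H 3, H 4, H 5, H 6, H 7)%N.
  rewrite /= !exp1n !exp0n // => -[[[[[]]]]].
  move: hmk; rewrite mE n6; do 6 rewrite big_ltn //; rewrite big_geq // exp1n.
  move: (2 ^ k)%N (3 ^ k)%N (4 ^ k)%N (5 ^ k)%N (6 ^ k)%N (7 ^ k)%N.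
  lia.
(* The remaining equations are [0 = 1], [1 = 2^k] and [1 + 2^k = 3^k]; the last one fails because
   [k >= 2]. *)
- move: hmk; rewrite mE; case: n n3 {mE} => [|[|[|//]]] _.
  + by rewrite big_geq // exp1n.
  + rewrite big_ltn // big_geq // exp1n addn0 => E.
    by have := ltn_exp2l 0 k (isT : 1 < 2)%N; rewrite hk expn0 -E.
  + rewrite 2?big_ltn // big_geq // exp1n addn0 => E.
    have : (1 + 2 ^ k < 3 ^ k)%N; last by rewrite E ltnn.
    rewrite -(subnK k2) addn2; elim: (k - 2)%N => [//|l IH].
    by rewrite (expnS 2) (expnS 3); lia.
Qed.

End ErdosMoser.

(** * Bounds for the exponential and the logarithm *)

(** By the mean value theorem. Applied to Taylor remainders, it reduces each bound to the sign of a
    derivative. *)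
Lemma is_derive_ge0 (R : realType) (f df : R -> R) (b : R) : 0 <= b ->
  f 0 = 0 ->
  (forall t, 0 <= t <= b -> is_derive t 1 f (df t)) ->
  (forall t, 0 <= t <= b -> 0 <= df t) -> 0 <= f b.
Proof.
move=> b0 f0 fd df0; rewrite -[X in X <= _]f0.
have [||c cb E] := @MVT_segment R f df 0 b b0.
- by move=> x; rewrite in_itv /= => /andP[x0 xb]; apply: fd; rewrite !ltW.
- apply: derivable_within_continuous => x; rewrite in_itv /= => /fd xfd.
  exact: ex_derive.
- rewrite -subr_ge0 E subr0 mulr_ge0 //; apply: df0.
  by move: cb; rewrite in_itv.
Qed.

Lemma expR_le_taylor2 (R : realType) (t : R) : t <= 0 ->
  expR t <= 1 + t + t ^+ 2 / 2.
Proof.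
move=> t0.
have : 0 <= 1 - (- t) + (- t) ^+ 2 / 2 - expR (- - t).
  apply: (@is_derive_ge0 R (fun s => 1 - s + s ^+ 2 / 2 - expR (- s))
    (fun s => -1 + s + expR (- s))) => [|||s _].
  - lra.
  - by rewrite oppr0 expR0 expr0n /=; lra.
  - move=> s _; apply: is_derive_eq; rewrite /GRing.scale /=; lra.
  - by have := expR_ge1Dx (- s); lra.
by rewrite opprK sqrrN; lra.
Qed.

Lemma expR_ge_taylor3 (R : realType) (t : R) :
  1 + t + t ^+ 2 / 2 + t ^+ 3 / 6 <= expR t.
Proof.
have [t0|t0] := leP t 0.
  have : 0 <= expR (- - t) - 1 + - t - (- t) ^+ 2 / 2 + (- t) ^+ 3 / 6.
    apply: (@is_derive_ge0 R
      (fun s => expR (- s) - 1 + s - s ^+ 2 / 2 + s ^+ 3 / 6)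
      (fun s => - expR (- s) + 1 - s + s ^+ 2 / 2)) => [|||s /andP[s0 _]].
    - lra.
    - by rewrite oppr0 expR0 !expr0n /=; lra.
    - move=> s _; apply: is_derive_eq; rewrite /GRing.scale /=; lra.
    - by have := @expR_le_taylor2 R (- s); rewrite sqrrN; lra.
  by rewrite opprK; lra.
have exp2 (s : R) : 0 <= s -> 0 <= expR s - (1 + s + s ^+ 2 / 2).
  move=> s0.
  apply: (@is_derive_ge0 R (fun s => expR s - (1 + s + s ^+ 2 / 2))
    (fun s => expR s - 1 - s)) => [//|||u _].
  - by rewrite expR0 expr0n /=; lra.
  - move=> u _; apply: is_derive_eq; rewrite /GRing.scale /=; lra.
  - by have := expR_ge1Dx u; lra.
rewrite -subr_ge0.
apply: (@is_derive_ge0 R (fun s => expR s - (1 + s + s ^+ 2 / 2 + s ^+ 3 / 6))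
    (fun s => expR s - (1 + s + s ^+ 2 / 2))) => [|||u /andP[/exp2 //]].
- lra.
- by rewrite expR0 !expr0n /=; lra.
- move=> u _; apply: is_derive_eq; rewrite /GRing.scale /=; lra.
Qed.

(** Since [e^t = 1 / e^(-t)], it is enough that the claimed bound times the cubic lower bound for
    [e^(-t)] is at least 1. *)
Lemma expR_le_taylor2_small (R : realType) (t : R) : 0 <= t <= 2^-1 ->
  expR t <= 1 + t + t ^+ 2 / 2 + t ^+ 3.
Proof.
move=> /andP[t0 t1]; rewrite -[t in expR t]opprK expRN.
have := @expR_ge_taylor3 R (- t); rewrite sqrrN => H.
have H0 : 0 < expR (- t) by apply: expR_gt0.
rewrite -[_^-1]mul1r ler_pdivrMr //.
set u := 1 + t + t ^+ 2 / 2 + t ^+ 3.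
have u0 : 0 <= u by rewrite /u; have := exprn_ge0 3 t0; nra.
apply: le_trans (ler_wpM2l u0 H).
rewrite -subr_ge0 [X in 0 <= X](_ : _ =
  t ^+ 3 * (10 - 11 * t + t ^+ 2 * (5 - 2 * t)) / 12); last by rewrite /u; field.
rewrite divr_ge0 // mulr_ge0 ?exprn_ge0 //.
have : 0 <= t ^+ 2 * (5 - 2 * t) by rewrite mulr_ge0 ?exprn_ge0 //; lra.
lra.
Qed.

Lemma is_derive_ln1B (R : realType) (s : R) : s < 1 ->
  is_derive s 1 (fun s => ln (1 - s)) (- (1 - s)^-1).
Proof.
move=> s1.
have h : is_derive (1 - s) 1 (@ln R) (1 - s)^-1 by apply: is_derive1_ln; lra.
have h3 : is_derive s 1 (fun s : R => 1 - s) (-1).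
  by apply: is_derive_eq; rewrite /GRing.scale /=; lra.
have := @is_derive1_comp R (@ln R) (fun s => 1 - s) s _ _ h h3.
by rewrite mulrN1.
Qed.

Lemma ln1B_le (R : realType) (y : R) : 0 <= y < 1 ->
  ln (1 - y) <= - y - y ^+ 2 / 2 - y ^+ 3 / 3.
Proof.
move=> /andP[y0 y1].
have : 0 <= - ln (1 - y) - y - y ^+ 2 / 2 - y ^+ 3 / 3; last by lra.
apply: (@is_derive_ge0 R (fun s => - ln (1 - s) - s - s ^+ 2 / 2 - s ^+ 3 / 3)
  (fun s => s ^+ 3 / (1 - s))) => [//||s|s] => [|/andP[s0 sy]|/andP[s0 sy]].
- by rewrite [1 - 0]subr0 ln1 !expr0n /=; lra.
- have s1 : s < 1 by lra.
  have h := is_derive_ln1B _ _ s1.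
  apply: is_derive_eq; rewrite /GRing.scale /=; field; lra.
- by rewrite divr_ge0 ?exprn_ge0 //; lra.
Qed.

(** The quartic coefficient 1/2, instead of the Taylor value 1/4, absorbs all higher terms on
    [y <= 1/2]: the derivative of the difference is [s^3 (1 - 2 s) / (1 - s)]. *)
Lemma ln1B_ge (R : realType) (y : R) : 0 <= y <= 2^-1 ->
  - y - y ^+ 2 / 2 - y ^+ 3 / 3 - y ^+ 4 / 2 <= ln (1 - y).
Proof.
move=> /andP[y0 y1].
have : 0 <= ln (1 - y) + y + y ^+ 2 / 2 + y ^+ 3 / 3 + y ^+ 4 / 2; last by lra.
apply: (@is_derive_ge0 R
  (fun s => ln (1 - s) + s + s ^+ 2 / 2 + s ^+ 3 / 3 + s ^+ 4 / 2)
  (fun s => s ^+ 3 * (1 - 2 * s) / (1 - s)))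
  => [//||s|s] => [|/andP[s0 sy]|/andP[s0 sy]].
- by rewrite [1 - 0]subr0 ln1 !expr0n /=; lra.
- have s1 : s < 1 by lra.
  have h := is_derive_ln1B _ _ s1.
  apply: is_derive_eq; rewrite /GRing.scale /=; field; lra.
- by rewrite divr_ge0 ?mulr_ge0 ?exprn_ge0 //; lra.
Qed.

(** * Expansion of the power sum *)

(** The precision is dictated by [second_coefficient], whose sign depends on
    [ln 2 < 25/36 = 0.6944...]. *)
Lemma ln2_bounds (R : realType) : 692 / 1000 <= ln (2 : R) <= 6934 / 10000.
Proof.
(* [2 = (16/15)^7 (25/24)^5 (81/80)^3] *)
have E : ln (2 : R) = - (ln (1 - 16^-1) *+ 7
    + ln (1 - 25^-1) *+ 5 + ln (1 - 81^-1) *+ 3).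
  apply/eqP; rewrite -subr_eq0 opprK -!lnXn; try lra.
  rewrite -!lnM ?posrE ?mulr_gt0 ?exprn_gt0 //; try lra.
  by rewrite [X in ln X](_ : _ = 1) ?ln1 //; field.
have b (y : R) : 0 <= y <= 2^-1 ->
    - y - y ^+ 2 / 2 - y ^+ 3 / 3 - y ^+ 4 / 2 <= ln (1 - y)
      <= - y - y ^+ 2 / 2 - y ^+ 3 / 3.
  by move=> /andP[y0 y1]; rewrite ln1B_ge ?ln1B_le ?y0 //=; lra.
have b' (y : R) : 0 <= y <= 25^-1 ->
    - y - 13 / 25 * y ^+ 2 <= ln (1 - y) <= - y - y ^+ 2 / 2.
  move=> /andP[y0 y1]; have y3 := exprn_ge0 3 y0.
  have y2 : y ^+ 3 <= y ^+ 2 / 25 by rewrite exprSr ler_wpM2l // sqr_ge0.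
  have y4 : y ^+ 4 <= y ^+ 3 / 25 by rewrite (exprSr _ 3) ler_wpM2l.
  have := b y; rewrite y0 (_ : y <= 2^-1) /=; last by lra.
  move=> /(_ isT) /andP[? ?].
  by apply/andP; split; lra.
have h1 : 451 / 1000 <= - ln (1 - 16^-1 : R) * 7 <= 4518 / 10000.
  have := b 16^-1 ltac:(lra); move: (ln _) => l {b b' E} /andP[? ?].
  by apply/andP; split; lra.
have h2 : 204 / 1000 <= - ln (1 - 25^-1 : R) * 5 <= 2042 / 10000.
  have := b' 25^-1 ltac:(lra); move: (ln _) => l {b b' E h1} /andP[? ?].
  by apply/andP; split; lra.
have h3 : 37 / 1000 <= - ln (1 - 81^-1 : R) * 3 <= 373 / 10000.
  have := b' 81^-1 ltac:(clear; lra); move: (ln _) => l {b b' E h1 h2} /andP[? ?].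
  by apply/andP; split; lra.
have -> : ln (2 : R) = - ln (1 - 16^-1 : R) * 7 + - ln (1 - 25^-1 : R) * 5
    + - ln (1 - 81^-1 : R) * 3.
  by rewrite E !mulr_natr !mulNrn !opprD.
move: h1 h2 h3 => /andP[h1 h1'] /andP[h2 h2'] /andP[h3 h3'].
apply/andP; split.
  by apply: le_trans (lerD (lerD h1 h2) h3); clear; lra.
by apply: le_trans (lerD (lerD h1' h2') h3') _; clear; lra.
Qed.

(** Telescoping: the hypothesis says [T (j+1) / 2^(j+1) = G j / 2^j - G (j+1) / 2^(j+1)]. Summing a
    polynomial against [2^-j] becomes a polynomial identity for [G]. *)
Lemma sum_div_pow2 (R : realType) (T G : nat -> R) (n : nat) :
  (forall j, T j.+1 + G j.+1 = 2 * G j) ->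
  \sum_(1 <= j < n.+1) T j / 2 ^+ j = G 0%N - G n / 2 ^+ n.
Proof.
move=> TG; elim: n => [|n IH]; first by rewrite big_geq // expr0 divr1 subrr.
rewrite big_nat_recr //= IH exprS.
have -> : G n = (T n.+1 + G n.+1) / 2 by rewrite TG; field.
by field; rewrite expf_neq0.
Qed.

(* The terms of degree 1 and 2 in the expansion of [2^J (1 - J x)^(L (m - 3/2))]
   in powers of [x = 1/m], where [L = ln 2]. *)
Definition second_order (R : realType) (L x J : R) : R :=
  L * ((3 * J - J ^+ 2) / 2) * x +
  (L * (3 * J ^+ 2 / 4 - J ^+ 3 / 3) + L ^+ 2 * (3 * J - J ^+ 2) ^+ 2 / 8) * x ^+ 2.

(** The exponent is [L (m - 3/2)] times the bound of [ln1B_le] at [J x], plus [L J], for [x = 1/m].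
    For [J >= 3] it is nonpositive, so the quadratic Taylor bound applies, and what exceeds
    [second_order] is of order [J^5 x^3]. *)
Lemma second_order_upper (R : realType) (L x J : R) :
  0 <= L <= 7 / 10 -> 0 <= x <= 100^-1 -> 3 <= J -> J * x <= 1 ->
  expR (L * x * ((3 * J - J ^+ 2) / 2 + x * (3 * J ^+ 2 / 4 - J ^+ 3 / 3)
                + x ^+ 2 * J ^+ 3 / 2))
  <= 1 + second_order R L x J + (J ^+ 5 / 5 + 5) * x ^+ 3.
Proof.
move=> /andP[L0 L1] /andP[x0 x1] J3 Jx.
set a := (3 * J - J ^+ 2) / 2.
set e := x * (3 * J ^+ 2 / 4 - J ^+ 3 / 3) + x ^+ 2 * J ^+ 3 / 2.
rewrite -addrA -/e.
have J0 : 0 <= J by lra.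
have a0 : a <= 0 by rewrite /a; nra.
have a1 : - (J ^+ 2 / 2) <= a by rewrite /a; nra.
have e0 : e <= 0.
  have -> : e = - (x * J ^+ 2 * (J / 3 - 3 / 4 - x * J / 2)) by rewrite /e; field.
  rewrite oppr_le0 mulr_ge0 ?mulr_ge0 ?exprn_ge0 //; nra.
have e1 : - (x * J ^+ 3 / 3) <= e.
  rewrite -subr_ge0 [X in 0 <= X](_ : _ = x * J ^+ 2 * (3 / 4 + x * J / 2)).
    by rewrite mulr_ge0 ?mulr_ge0 ?exprn_ge0 //; nra.
  by rewrite /e; field.
set v := L * x * (a + e).
have v0 : v <= 0 by rewrite /v mulr_ge0_le0 ?mulr_ge0 //; lra.
apply: le_trans (expR_le_taylor2 _ _ v0) _.
have -> : 1 + v + v ^+ 2 / 2 =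
    1 + second_order R L x J + (L * (x ^+ 3 * J ^+ 3) / 2
    + L ^+ 2 * (x ^+ 2 * (a * e + e ^+ 2 / 2))).
  by rewrite /v /second_order /e /a; field.
rewrite lerD2l.
set A := x ^+ 3 * J ^+ 5.
have x2 : 0 <= x ^+ 2 by apply: exprn_ge0.
have x3 : 0 <= x ^+ 3 by apply: exprn_ge0.
have h1 : 0 <= x ^+ 3 * J ^+ 3 <= A / 9.
  rewrite mulr_ge0 ?exprn_ge0 //=.
  have -> : A / 9 = x ^+ 3 * J ^+ 3 * (J ^+ 2 / 9) by rewrite /A; field.
  by rewrite ler_peMr ?mulr_ge0 ?exprn_ge0 //; nra.
have h2 : a * e <= x * J ^+ 5 / 6.
  have -> : x * J ^+ 5 / 6 = (J ^+ 2 / 2) * (x * J ^+ 3 / 3) by field.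
  by rewrite -mulrNN ler_pM // ?oppr_ge0 //; lra.
have h3 : e ^+ 2 <= x * J ^+ 5 / 9.
  apply: (@le_trans _ _ ((x * J ^+ 3 / 3) ^+ 2)).
    by rewrite -sqrrN ler_pM // ?oppr_ge0 //; lra.
  have -> : (x * J ^+ 3 / 3) ^+ 2 = (x * J ^+ 5 / 9) * (J * x) by field.
  by rewrite ler_piMr // divr_ge0 // mulr_ge0 ?exprn_ge0.
have h4 : x ^+ 2 * (a * e + e ^+ 2 / 2) <= 2 / 9 * A.
  have -> : 2 / 9 * A = x ^+ 2 * (x * J ^+ 5 * 2 / 9) by rewrite /A; field.
  by rewrite ler_wpM2l //; lra.
have A0 : 0 <= A by rewrite mulr_ge0 ?exprn_ge0.
have h5 : 0 <= a * e by rewrite -mulrNN mulr_ge0 ?oppr_ge0.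
have h6 : 0 <= x ^+ 2 * (a * e + e ^+ 2 / 2).
  by rewrite mulr_ge0 // addr_ge0 // divr_ge0 // sqr_ge0.
have -> : (J ^+ 5 / 5 + 5) * x ^+ 3 = A / 5 + 5 * x ^+ 3 by rewrite /A; field.
have L2 : 0 <= L ^+ 2 <= 49 / 100 by rewrite sqr_ge0 /=; nra.
move: h1 L2 => /andP[h1 h1'] /andP[L2 L2'].
set B := x ^+ 3 * J ^+ 3 in h1 h1' *.
set C := x ^+ 2 * _ in h4 h6 *.
have : L * B <= 7 / 10 * (A / 9) by rewrite ler_pM.
have : L ^+ 2 * C <= 49 / 100 * (2 / 9 * A) by rewrite ler_pM.
lra.
Qed.

(** For [J = 1] and [J = 2] the leading factor [(3 J - J^2) / 2] is 1 and the exponent is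
    nonnegative. The bound for small positive arguments replaces the previous one; the constant 5 in
    the error is for these two cases. *)
Lemma second_order_upper_small (R : realType) (L x J : R) :
  0 <= L <= 7 / 10 -> 0 <= x <= 100^-1 -> J = 1 \/ J = 2 ->
  expR (L * x * ((3 * J - J ^+ 2) / 2 + x * (3 * J ^+ 2 / 4 - J ^+ 3 / 3)
                + x ^+ 2 * J ^+ 3 / 2))
  <= 1 + second_order R L x J + (J ^+ 5 / 5 + 5) * x ^+ 3.
Proof.
move=> /andP[L0 L1] /andP[x0 x1] J12.
set e := x * (3 * J ^+ 2 / 4 - J ^+ 3 / 3) + x ^+ 2 * J ^+ 3 / 2.
rewrite -addrA -/e.
have -> : (3 * J - J ^+ 2) / 2 = 1 by case: J12 => ->; field.
have xx : 0 <= x ^+ 2 <= x / 100 by rewrite sqr_ge0 /=; nra.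
move: xx => /andP[xx0 xx1].
have e0 : 0 <= e <= x / 2.
  by rewrite /e; case: J12 => ->; rewrite ?expr1n; apply/andP; split; lra.
move: e0 => /andP[e0 e1].
set v := L * x * (1 + e).
have v0 : 0 <= v by rewrite /v !mulr_ge0 //; lra.
have vx : v <= x.
  have : L * x <= 7 / 10 * x by rewrite ler_wpM2r.
  rewrite /v; nra.
have v1 : 0 <= v <= 2^-1 by rewrite v0 /=; lra.
apply: le_trans (expR_le_taylor2_small _ _ v1) _.
have v3 : v ^+ 3 <= x ^+ 3 by rewrite lerXn2r ?nnegrE.
have x3 : 0 <= x ^+ 3 by apply: exprn_ge0.
have -> : 1 + v + v ^+ 2 / 2 =
    1 + second_order R L x J + (L * (x ^+ 3 * J ^+ 3) / 2
    + L ^+ 2 * (x ^+ 2 * (e + e ^+ 2 / 2))).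
  by rewrite /v /second_order /e; case: J12 => ->; field.
have h1 : L * (x ^+ 3 * J ^+ 3) <= 7 / 10 * (x ^+ 3 * 8).
  by rewrite ler_pM //; case: J12 => ->; rewrite ?expr1n; lra.
have h2 : x ^+ 2 * (e + e ^+ 2 / 2) <= x ^+ 3.
  have -> : x ^+ 3 = x ^+ 2 * x by ring.
  by rewrite ler_wpM2l //; nra.
have h3 : L ^+ 2 * (x ^+ 2 * (e + e ^+ 2 / 2)) <= 49 / 100 * x ^+ 3.
  rewrite ler_pM ?sqr_ge0 //; last by nra.
  by rewrite mulr_ge0 // addr_ge0 // divr_ge0 // sqr_ge0.
have : 0 <= J ^+ 5 / 5 * x ^+ 3.
  by rewrite mulr_ge0 // divr_ge0 // exprn_ge0 //; case: J12 => ->.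
lra.
Qed.

(** The exponent may have either sign, so the cubic Taylor bound, valid on the whole line, is used.
    The errors [J^4 / 2], [J^5 / 3] and [J^6 / 8] come from the logarithm, from the square and from
    the cube of the exponent. *)
Lemma second_order_lower (R : realType) (L x J : R) :
  0 <= L <= 7 / 10 -> 0 <= x -> 1 <= J -> J * x <= 2^-1 ->
  1 + second_order R L x J - (J ^+ 4 / 2 + J ^+ 5 / 3 + J ^+ 6 / 8) * x ^+ 3 <=
  expR (L * x * ((3 * J - J ^+ 2) / 2 + x * (3 * J ^+ 2 / 4 - J ^+ 3 / 3)
                + x ^+ 2 * (J ^+ 3 - J ^+ 4) / 2)).
Proof.
move=> /andP[L0 L1] x0 J1 Jx.
set a := (3 * J - J ^+ 2) / 2.
set e := x * (3 * J ^+ 2 / 4 - J ^+ 3 / 3) + x ^+ 2 * (J ^+ 3 - J ^+ 4) / 2.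
rewrite -[X in expR (_ * X)]addrA -/e.
have J0 : 0 <= J by lra.
have J2 : J <= J ^+ 2 by nra.
have a1 : `|a| <= J ^+ 2 by rewrite ler_norml /a; apply/andP; split; lra.
have e1 : `|e| <= x * J ^+ 3 * (7 / 12).
  rewrite ler_norml; apply/andP; split; rewrite -subr_ge0.
    rewrite [X in 0 <= X](_ : _ = x * J ^+ 2 * (3 / 4 + x * J / 2
       + J * (2^-1 - J * x) / 2)); last by rewrite /e; field.
    rewrite mulr_ge0 ?mulr_ge0 ?exprn_ge0 //.
    rewrite addr_ge0 ?addr_ge0 ?divr_ge0 ?mulr_ge0 //; lra.
  rewrite [X in 0 <= X](_ : _ = x * J ^+ 2 * (3 / 4 * (J - 1) + J / 6 + J * x * (J - 1) / 2)).
    rewrite mulr_ge0 ?mulr_ge0 ?exprn_ge0 //.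
    have : 0 <= J * x * (J - 1) / 2 by rewrite divr_ge0 // !mulr_ge0 //; lra.
    lra.
  by rewrite /e; field.
set v := L * x * (a + e).
apply: le_trans (expR_ge_taylor3 _ v).
have -> : 1 + v + v ^+ 2 / 2 =
    1 + second_order R L x J + (- (L * (x ^+ 3 * (J ^+ 4 - J ^+ 3)) / 2)
    + L ^+ 2 * (x ^+ 2 * (a * e + e ^+ 2 / 2))).
  by rewrite /v /second_order /e /a; field.
have x2 : 0 <= x ^+ 2 by apply: exprn_ge0.
have x3 : 0 <= x ^+ 3 by apply: exprn_ge0.
have J3 : 0 <= J ^+ 3 by apply: exprn_ge0.
have L2 : 0 <= L ^+ 2 <= 49 / 100 by rewrite sqr_ge0 /=; nra.
move: L2 => /andP[L2 L2'].
have h1 : L * (x ^+ 3 * (J ^+ 4 - J ^+ 3)) <= 1 * (x ^+ 3 * J ^+ 4).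
  rewrite ler_pM //; last by rewrite ler_wpM2l //; lra.
    rewrite mulr_ge0 // (_ : _ - _ = J ^+ 3 * (J - 1)); last by ring.
    by rewrite mulr_ge0 //; lra.
  lra.
have h2 : - (3^-1 * (x ^+ 3 * J ^+ 5)) <= L ^+ 2 * (x ^+ 2 * (a * e + e ^+ 2 / 2)).
  have ae : `|a * e| <= x * J ^+ 5 * (7 / 12).
    rewrite normrM (_ : x * _ * _ = J ^+ 2 * (x * J ^+ 3 * (7 / 12))).
      by rewrite ler_pM.
    by ring.
  have X0 : 0 <= x * J ^+ 5 by rewrite mulr_ge0 ?exprn_ge0.
  have h : - (x * J ^+ 5 * (7 / 12)) <= a * e + e ^+ 2 / 2.
    move: ae; rewrite ler_norml => /andP[ae _].
    have := sqr_ge0 e; lra.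
  have h' := ler_wpM2l L2 (ler_wpM2l x2 h).
  apply: le_trans h'.
  rewrite (_ : x ^+ 2 * _ = - (x ^+ 3 * J ^+ 5 * (7 / 12))); last by ring.
  have : L ^+ 2 * (x ^+ 3 * J ^+ 5) <= 49 / 100 * (x ^+ 3 * J ^+ 5).
    by rewrite ler_wpM2r // mulr_ge0 // exprn_ge0.
  have : 0 <= x ^+ 3 * J ^+ 5 by rewrite mulr_ge0 // exprn_ge0.
  lra.
have h3 : `|v ^+ 3| <= 3 / 4 * (x ^+ 3 * J ^+ 6).
  have vv : `|v| <= 7 / 10 * (31 / 24) * (x * J ^+ 2).
    have ae : `|a + e| <= J ^+ 2 * (31 / 24).
      apply: le_trans (ler_normD _ _) _.
      apply: le_trans (lerD a1 e1) _.
      have -> : x * J ^+ 3 = J ^+ 2 * (J * x) by ring.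
      have : J ^+ 2 * (J * x) <= J ^+ 2 * 2^-1 by rewrite ler_wpM2l // sqr_ge0.
      lra.
    rewrite /v normrM (ger0_norm (mulr_ge0 L0 x0)).
    rewrite (_ : _ * (x * _) = 7 / 10 * x * (J ^+ 2 * (31 / 24))); last by ring.
    by rewrite ler_pM ?mulr_ge0 // ler_wpM2r.
  rewrite normrX.
  have : `|v| ^+ 3 <= (7 / 10 * (31 / 24) * (x * J ^+ 2)) ^+ 3.
    by rewrite lerXn2r ?nnegrE // !mulr_ge0 ?sqr_ge0 //; lra.
  rewrite exprMn (_ : (x * J ^+ 2) ^+ 3 = x ^+ 3 * J ^+ 6); last by ring.
  have : (7 / 10 * (31 / 24)) ^+ 3 <= 3 / 4 :> R by lra.
  have : 0 <= x ^+ 3 * J ^+ 6 by rewrite mulr_ge0 // exprn_ge0.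
  by move=> /[swap] /ler_wpM2r /[apply]; move=> /[swap]; apply: le_trans.
move: h3; rewrite ler_norml => /andP[h3 _].
have : 0 <= x ^+ 3 * J ^+ 4 by rewrite mulr_ge0 // exprn_ge0.
have : 0 <= x ^+ 3 * J ^+ 6 by rewrite mulr_ge0 // exprn_ge0.
rewrite !mulrDl; lra.
Qed.

(** With [q = n / 16] rounded down, [n <= 17 q] and [17^2 <= q], so [n^9 <= 17^9 q^9 <= q^16 <=
    2^(16 q) <= 2^n]. *)
Lemma expn9_le_expn2 (n : nat) : (5000 <= n)%N -> (n ^ 9 <= 2 ^ n)%N.
Proof.
move=> n5; set q := (n %/ 16)%N.
have nq : (n <= 17 * q)%N by rewrite /q; lia.
have q17 : (17 * 17 <= q)%N by rewrite /q; lia.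
have qn : (q * 16 <= n)%N by rewrite /q; lia.
apply: (@leq_trans (q ^ 16)).
  apply: (@leq_trans ((17 * q) ^ 9)); first by rewrite leq_exp2r.
  rewrite expnMn -[16%N]/(7 + 9)%N expnD leq_mul2r; apply/orP; right.
  apply: (@leq_trans ((17 * 17) ^ 7)); last by rewrite leq_exp2r.
  by rewrite mulnn -expnM leq_exp2l.
apply: (@leq_trans ((2 ^ q) ^ 16)); first by rewrite leq_exp2r // ltnW // ltn_expl.
by rewrite -expnM leq_exp2l.
Qed.

(* [second_order_tail L x n / 2^n] is the sum over [j > n] of
   [(1 + second_order L x j) / 2^j]; [g_i] comes from the monomial [j^i]. *)
Definition second_order_tail (R : realType) (L x n : R) : R :=
  let g1 := n + 2 in
  let g2 := n ^+ 2 + 4 * n + 6 in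
  let g3 := n ^+ 3 + 6 * n ^+ 2 + 18 * n + 26 in
  let g4 := n ^+ 4 + 8 * n ^+ 3 + 36 * n ^+ 2 + 104 * n + 150 in
  1 + L * x * ((3 * g1 - g2) / 2) +
  x ^+ 2 * (L * (3 * g2 / 4 - g3 / 3) + L ^+ 2 * (9 * g2 - 6 * g3 + g4) / 8).

Lemma second_order_tail_le (R : realType) (L x n : R) :
  0 <= L <= 1 -> 0 <= x <= 1 -> 1 <= n ->
  `|second_order_tail R L x n| <= 2000 * n ^+ 4.
Proof.
move=> /andP[L0 L1] /andP[x0 x1] n1; rewrite /second_order_tail.
set g1 := n + 2; set g2 := n ^+ 2 + 4 * n + 6.
set g3 := n ^+ 3 + _ + _ + _; set g4 := n ^+ 4 + _ + _ + _ + _.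
have n0 : 0 <= n by lra.
have p2 : n <= n ^+ 2 by nra.
have p3 : n ^+ 2 <= n ^+ 3 by rewrite (exprSr _ 2) ler_peMr // sqr_ge0.
have p4 : n ^+ 3 <= n ^+ 4 by rewrite (exprSr _ 3) ler_peMr // exprn_ge0.
have h1 : 0 <= g1 <= 299 * n ^+ 4 by rewrite /g1; lra.
have h2 : 0 <= g2 <= 299 * n ^+ 4 by rewrite /g2; lra.
have h3 : 0 <= g3 <= 299 * n ^+ 4 by rewrite /g3; lra.
have h4 : 0 <= g4 <= 299 * n ^+ 4 by rewrite /g4; lra.
have h5 : 1 <= n ^+ 4 by lra.
have prod (a b c : R) : 0 <= a <= 1 -> `|b| <= c -> `|a * b| <= c.
  move=> /andP[a0 a1] bc; rewrite normrM (ger0_norm a0).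
  by apply: le_trans bc; rewrite ler_piMl.
have Lx : 0 <= L * x <= 1 by rewrite mulr_ge0 //= mulr_ile1.
have LL : 0 <= L ^+ 2 <= 1 by rewrite sqr_ge0 expr_le1.
have xx : 0 <= x ^+ 2 <= 1 by rewrite sqr_ge0 expr_le1.
move: (n ^+ 4) h1 h2 h3 h4 h5 => N.
move: g1 g2 g3 g4 => {p2 p3 p4} g1 g2 g3 g4 h1 h2 h3 h4 h5.
have b1 : `|L * x * ((3 * g1 - g2) / 2)| <= 450 * N.
  by apply: prod => //; rewrite ler_norml; lra.
have b2 : `|L * (3 * g2 / 4 - g3 / 3)| <= 300 * N.
  by apply: prod => //; rewrite ?L0 // ler_norml; lra.
have b3 : `|L ^+ 2 * ((9 * g2 - 6 * g3 + g4) / 8)| <= 400 * N.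
  by apply: prod => //; rewrite ler_norml; lra.
have b4 : `|x ^+ 2 * (L * (3 * g2 / 4 - g3 / 3)
    + L ^+ 2 * (9 * g2 - 6 * g3 + g4) / 8)| <= 700 * N.
  apply: prod => //; rewrite -[_ * _ / 8]mulrA; apply: le_trans (ler_normD _ _) _.
  lra.
apply: le_trans (ler_normD _ _) _; apply: le_trans (lerD (ler_normD _ _) b4) _.
rewrite normr1; lra.
Qed.

(** The main value is [second_order_tail] at 0, where [g1, g2, g3, g4] are 2, 6, 26, 150. The
    coefficient of [x] vanishes because [3 * 2 = 6]. *)
Lemma sum_second_order (R : realType) (L x : R) (n : nat) :
  0 <= L <= 1 -> 0 <= x <= 1 -> (0 < n)%N ->
  `|\sum_(1 <= j < n.+1) (1 + second_order R L x j%:R) / 2 ^+ j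
    - (1 + (6 * L ^+ 2 - 25 / 6 * L) * x ^+ 2)|
  <= 2000 * n%:R ^+ 4 / 2 ^+ n.
Proof.
move=> L01 x01 n0.
rewrite (@sum_div_pow2 R (fun j => 1 + second_order R L x j%:R)
    (fun j => second_order_tail R L x j%:R)); last first.
  by move=> j; rewrite -natr1 /second_order_tail /second_order; field.
rewrite [X in `|X|](_ : _ = - (second_order_tail R L x n%:R / 2 ^+ n)); last first.
  by rewrite {1}/second_order_tail; field; rewrite expf_neq0.
rewrite normrN normrM normfV (ger0_norm (exprn_ge0 n (ler0n R 2))).
rewrite ler_pM2r ?invr_gt0 ?exprn_gt0 //.
by apply: second_order_tail_le; rewrite // ler1n.
Qed.

(** The series of [j^5 / 2^j] sums to 1082, and [1082 / 5 + 5 < 222]. *)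
Lemma sum_upper_error (R : realType) (n : nat) :
  \sum_(1 <= j < n.+1) (j%:R ^+ 5 / 5 + 5) / 2 ^+ j <= 222 :> R.
Proof.
rewrite (@sum_div_pow2 R (fun j => j%:R ^+ 5 / 5 + 5) (fun j => (j%:R ^+ 5
  + 10 * j%:R ^+ 4 + 60 * j%:R ^+ 3 + 260 * j%:R ^+ 2 + 750 * j%:R + 1082) / 5 + 5)).
  rewrite lerBlDr; apply: ler_wpDr; last by lra.
  apply: divr_ge0; last exact: exprn_ge0.
  have p i : 0 <= (n%:R : R) ^+ i by apply: exprn_ge0.
  by move: (p 1%N) (p 2%N) (p 3%N) (p 4%N) (p 5%N) (p 6%N); rewrite expr1; lra.
by move=> j; rewrite -natr1; field.
Qed.

(** The series of [j^i / 2^j] for [i = 4, 5, 6] sum to 150, 1082 and 9366, and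
    [150 / 2 + 1082 / 3 + 9366 / 8 < 1607]. *)
Lemma sum_lower_error (R : realType) (n : nat) :
  \sum_(1 <= j < n.+1) (j%:R ^+ 4 / 2 + j%:R ^+ 5 / 3 + j%:R ^+ 6 / 8) / 2 ^+ j
  <= 1607 :> R.
Proof.
rewrite (@sum_div_pow2 R (fun j => j%:R ^+ 4 / 2 + j%:R ^+ 5 / 3 + j%:R ^+ 6 / 8)
  (fun j => (j%:R ^+ 4 + 8 * j%:R ^+ 3 + 36 * j%:R ^+ 2 + 104 * j%:R + 150) / 2
  + (j%:R ^+ 5
  + 10 * j%:R ^+ 4 + 60 * j%:R ^+ 3 + 260 * j%:R ^+ 2 + 750 * j%:R + 1082) / 3
  + (j%:R ^+ 6 + 12 * j%:R ^+ 5
  + 90 * j%:R ^+ 4 + 520 * j%:R ^+ 3 + 2250 * j%:R ^+ 2 + 6492 * j%:R + 9366) / 8)).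
  rewrite lerBlDr; apply: ler_wpDr; last by lra.
  apply: divr_ge0; last exact: exprn_ge0.
  have p i : 0 <= (n%:R : R) ^+ i by apply: exprn_ge0.
  by move: (p 1%N) (p 2%N) (p 3%N) (p 4%N) (p 5%N) (p 6%N); rewrite expr1; lra.
by move=> j; rewrite -natr1; field.
Qed.

(** * Terms of the power sum at the critical exponent *)

Lemma ln2_ge0_le (R : realType) : 0 <= ln (2 : R) <= 7 / 10.
Proof.
have /andP[L0 L1] := ln2_bounds R; apply/andP; split.
  by clear - L0; lra.
by clear - L1; lra. Qed.

Lemma expR_ln2_mulN (R : realType) (j : nat) (v : R) :
  expR (- (ln 2 * j%:R) + v) = expR v / 2 ^+ j.
Proof. by rewrite expRD expRN expRM_natr lnK ?posrE // mulrC. Qed.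

(** For [j < m] this is the power [(1 - j/m)^K] with a real exponent. *)
Definition moser_term (R : realType) (m j : nat) (K : R) : R :=
  expR (K * ln (1 - j%:R / m%:R)).

Definition critical_exponent (R : realType) (m : nat) : R := ln 2 * (m%:R - 3 / 2).

Lemma term_upper (R : realType) (m j : nat) : (100 <= m)%N -> (0 < j < m)%N ->
  moser_term R m j (critical_exponent R m) <=
  (1 + second_order R (ln 2) m%:R^-1 j%:R + (j%:R ^+ 5 / 5 + 5) * m%:R^-1 ^+ 3)
  / 2 ^+ j.
Proof.
move=> m100 /andP[j0 jm]; rewrite /moser_term /critical_exponent.
have L := ln2_ge0_le R; move: (ln (2 : R)) L (@expR_ln2_mulN R j) => L L01 EL.
have m100R : 100 <= (m%:R : R) by rewrite ler_nat.
have M0 : (m%:R : R) != 0 by rewrite gt_eqF; lra.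
have x01 : 0 <= (m%:R : R)^-1 <= 100^-1.
  by rewrite invr_ge0 ler0n /= lef_pV2 ?posrE //; lra.
have jR : 1 <= (j%:R : R) by rewrite ler1n.
have jmR : (j%:R : R) / m%:R < 1.
  by rewrite ltr_pdivrMr; [rewrite mul1r ltr_nat | lra].
set J := j%:R in jR jmR EL *; set M := m%:R in m100R M0 x01 jmR *.
have y0 : 0 <= J / M < 1 by rewrite jmR divr_ge0 //; lra.
have := @ln1B_le R (J / M) y0; move: (ln _) => l lE.
have L0 : 0 <= L by case/andP: L01.
have : L * (M - 3 / 2) * l <= - (L * J) + L * M^-1 * ((3 * J - J ^+ 2) / 2
    + M^-1 * (3 * J ^+ 2 / 4 - J ^+ 3 / 3) + M^-1 ^+ 2 * J ^+ 3 / 2).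
  apply: le_trans (ler_wpM2l _ lE) _; first by rewrite mulr_ge0 //; lra.
  by rewrite le_eqVlt; apply/orP; left; apply/eqP; field.
move=> h; rewrite -ler_expR in h; apply: le_trans h _; rewrite EL ler_wpM2r //.
have [j3|j3] := ltnP 2 j.
  by apply: second_order_upper => //; [rewrite (ler_nat _ 3)|exact: ltW].
apply: second_order_upper_small => //.
by rewrite /J; case: j j0 j3 {jm J jR jmR EL y0 lE} => [//|[|[|//]]] _ _; [left|right].
Qed.

Lemma term_lower (R : realType) (m j : nat) : (100 <= m)%N -> (0 < j)%N ->
  (j.*2 <= m)%N ->
  (1 + second_order R (ln 2) m%:R^-1 j%:R
    - (j%:R ^+ 4 / 2 + j%:R ^+ 5 / 3 + j%:R ^+ 6 / 8) * m%:R^-1 ^+ 3)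
  / 2 ^+ j <= moser_term R m j (critical_exponent R m).
Proof.
move=> m100 j0 jm; rewrite /moser_term /critical_exponent.
have L := ln2_ge0_le R; move: (ln (2 : R)) L (@expR_ln2_mulN R j) => L L01 EL.
have m100R : 100 <= (m%:R : R) by rewrite ler_nat.
have M0 : (m%:R : R) != 0 by rewrite gt_eqF; lra.
have x0 : 0 <= (m%:R : R)^-1 by rewrite invr_ge0 ler0n.
have jR : 1 <= (j%:R : R) by rewrite ler1n.
have jmR : (j%:R : R) / m%:R <= 2^-1.
  rewrite ler_pdivrMr; last by lra.
  have : (j.*2%:R : R) <= m%:R by rewrite ler_nat.
  by rewrite -muln2 natrM; lra.
set J := j%:R in jR jmR EL *; set M := m%:R in m100R M0 x0 jmR *.
have y0 : 0 <= J / M <= 2^-1 by rewrite jmR divr_ge0 //; lra.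
have := @ln1B_ge R (J / M) y0; move: (ln _) => l lE.
have L0 : 0 <= L by case/andP: L01.
have : - (L * J) + L * M^-1 * ((3 * J - J ^+ 2) / 2
    + M^-1 * (3 * J ^+ 2 / 4 - J ^+ 3 / 3) + M^-1 ^+ 2 * (J ^+ 3 - J ^+ 4) / 2)
    <= L * (M - 3 / 2) * l.
  apply: le_trans (ler_wpM2l _ lE); last by rewrite mulr_ge0 //; lra.
  (* The discarded term is the product of [- 3/2] and the quartic term [- y^4 / 2] of the logarithm
     bound. *)
  rewrite -subr_ge0 [X in 0 <= X](_ : _ = L * (3 / 4 * (J * M^-1) ^+ 4)).
    by rewrite mulr_ge0 // mulr_ge0 // exprn_ge0 // mulr_ge0 //; lra.
  by field.
move=> h; rewrite -ler_expR in h; apply: le_trans h; rewrite EL ler_wpM2r //.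
exact: second_order_lower.
Qed.

(** Divide the equation by [m^k] and reverse the summation by [i = m - j]. *)
Lemma sum_term_eq1 (R : realType) (m k : nat) : (0 < m)%N ->
  (\sum_(1 <= i < m) i ^ k = m ^ k)%N ->
  \sum_(1 <= j < m) moser_term R m j k%:R = 1.
Proof.
move=> m0 hmk; have M0 : (m%:R : R) != 0 by rewrite pnatr_eq0 -lt0n.
apply: (mulIf (expf_neq0 k M0)); rewrite mul1r mulr_suml -[RHS]natrX -hmk natr_sum.
rewrite [RHS]big_nat_rev /= add1n.
apply: eq_big_nat => j /andP[j0 jm]; rewrite subSS.
have y0 : 0 < 1 - (j%:R : R) / m%:R.
  by rewrite subr_gt0 ltr_pdivrMr ?mul1r ?ltr_nat // ltr0n.
rewrite /moser_term expRM_natl lnK ?posrE // !natrX -exprMn natrB ?(ltnW jm) //.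
by congr (_ ^+ k); field.
Qed.

Lemma tail_le (R : realType) (m n : nat) : (5000 <= n)%N -> (m <= 4 * n)%N ->
  (0 < m)%N -> 2000 * n%:R ^+ 4 / 2 ^+ n <= (m%:R : R)^-1 ^+ 3.
Proof.
move=> n5 mn m0.
have nR : 5000 <= (n%:R : R) by rewrite ler_nat.
have mR : (m%:R : R) <= 4 * n%:R by rewrite -natrM ler_nat.
have M0 : 0 < (m%:R : R) by rewrite ltr0n.
have P0 : 0 < (2 : R) ^+ n by rewrite exprn_gt0.
rewrite exprVn ler_pdivrMr // [X in _ <= X]mulrC ler_pdivlMr ?exprn_gt0 //.
have h : (n%:R : R) ^+ 9 <= 2 ^+ n by rewrite -!natrX ler_nat expn9_le_expn2.
apply: le_trans h.
have h3 : (m%:R : R) ^+ 3 <= (4 * n%:R) ^+ 3 by rewrite lerXn2r ?nnegrE //; lra.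
move: (n%:R : R) nR h3 {mR} => N nR h3.
have N0 : 0 <= N by clear - nR; lra.
have N4 : 0 <= 2000 * N ^+ 4 by apply: mulr_ge0; [exact: ler0n|exact: exprn_ge0].
apply: le_trans (ler_wpM2l N4 h3) _.
(* The constant is [2000 * 4^3 = 320 * 400]. *)
rewrite -subr_ge0 [X in 0 <= X](_ : _ = N ^+ 7 * (N ^+ 2 - 320 * 400)); last first.
  by clear; ring.
apply: mulr_ge0; first exact: exprn_ge0.
by clear - nR; nra.
Qed.

(** The coefficient is [- 6 L (25/36 - L)], and [25/36 - L] lies between 1/1000 and 5/2000. *)
Lemma second_coefficient (R : realType) :
  - (1 / 90) <= 6 * ln (2 : R) ^+ 2 - 25 / 6 * ln 2 <= - (1 / 250).
Proof.
have := ln2_bounds R; move: (ln 2) => L /andP[L0 L1].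
have -> : 6 * L ^+ 2 - 25 / 6 * L = - (6 * L * (25 / 36 - L)) by field.
rewrite !lerN2; apply/andP; split.
  apply: (@le_trans _ _ (6 * (7 / 10) * (5 / 2000))); last by clear; lra.
  apply: ler_pM; first by clear - L0; lra.
  - by clear - L1; lra.
  - by clear - L1; lra.
  - by clear - L0; lra.
apply: (@le_trans _ _ (6 * (692 / 1000) * (1 / 1000))); first by clear; lra.
apply: ler_pM; first by clear; lra.
- by clear; lra.
- by clear - L0; lra.
- by clear - L1; lra.
Qed.

(** * The power sum at the critical exponent for large moduli *)

Section LargeModulus.
Variables (R : realType) (m : nat).
Hypothesis hm : (2 ^ 16 < m)%N.
Let x : R := m%:R^-1.

Lemma modulus_ge : (5000.*2 <= m)%N.
Proof. by apply: leq_trans (ltnW hm). Qed.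

(** This holds because [250^2 < 2^16]. It turns cubic errors into quadratic ones:
    [250 x^3 <= x^2 / 250]. *)
Lemma modulus_inv_bounds : 0 < x /\ 250 * x <= 250^-1.
Proof.
have M0 : 0 < (m%:R : R) by rewrite ltr0n; apply: leq_trans modulus_ge.
split; first by rewrite invr_gt0.
rewrite ler_pdivrMr // [X in _ <= X]mulrC ler_pdivlMr ?ltr0n // -natrM ler_nat.
by apply: leq_trans (ltnW hm).
Qed.

Lemma sum_second_order_modulus (n : nat) : (5000 <= n)%N -> (m <= 4 * n)%N ->
  `|\sum_(1 <= j < n.+1) (1 + second_order R (ln 2) x j%:R) / 2 ^+ j
    - (1 + (6 * ln 2 ^+ 2 - 25 / 6 * ln 2) * x ^+ 2)| <= x ^+ 3.
Proof.
move=> n5 mn; have [x0 x1] := modulus_inv_bounds.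
have m5 := modulus_ge.
apply: le_trans (tail_le R m n n5 mn _); last by apply: leq_trans m5.
apply: sum_second_order; last by apply: leq_trans n5.
  by have /andP[-> h] := ln2_ge0_le R; apply: le_trans h _; lra.
by rewrite (ltW x0) /=; lra.
Qed.

(** The cubic errors total [(222 + 1) x^3 < 250 x^3 <= x^2 / 250], which the negative second
    coefficient outweighs. *)
Lemma sum_term_lt1 : \sum_(1 <= j < m) moser_term R m j (critical_exponent R m) < 1.
Proof.
have [x0 x1] := modulus_inv_bounds; have m5 := modulus_ge.
have [n mE] : exists n, m = n.+1 by exists m.-1; rewrite prednK //; apply: leq_trans m5.
have x3 : 0 <= x ^+ 3 by apply: exprn_ge0; apply: ltW.
have x2 : 0 < x ^+ 2 by apply: exprn_gt0.
have S1 : \sum_(1 <= j < m) moser_term R m j (critical_exponent R m) <=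
    \sum_(1 <= j < n.+1) (1 + second_order R (ln 2) x j%:R) / 2 ^+ j
    + (\sum_(1 <= j < n.+1) (j%:R ^+ 5 / 5 + 5) / 2 ^+ j) * x ^+ 3.
  rewrite mulr_suml -big_split {1}mE /=; apply: ler_sum_nat => j /andP[j0 jn].
  have -> : forall a b c d : R, a / d + b / d * c = (a + b * c) / d.
    by move=> a b c d; rewrite mulrDl mulrAC.
  by apply: term_upper; [apply: leq_trans m5|rewrite j0 mE].
have S2 := @sum_upper_error R n.
have := sum_second_order_modulus n.
have -> : (5000 <= n)%N by rewrite -ltnS -mE; apply: leq_trans m5.
have -> : (m <= 4 * n)%N.
  by have : (1 < m)%N; [apply: leq_trans m5 | clear - mE; lia].
move=> /(_ isT isT); rewrite ler_norml => /andP[_ S3].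
have S4 := ler_wpM2r x3 S2.
have /andP[_ c] := second_coefficient R.
have S5 := ler_wpM2r (ltW x2) c.
have S6 : 250 * x ^+ 3 <= 1 / 250 * x ^+ 2.
  rewrite mul1r (_ : 250 * x ^+ 3 = 250 * x * x ^+ 2); last by clear; ring.
  exact (ler_wpM2r (ltW x2) x1).
have x3' : 0 < x ^+ 3 by apply: exprn_gt0.
apply: le_lt_trans S1 _.
move: S3 S4 S5 S6 x3'; clear.
move: (\sum_(_ <= _ < _) _) (\sum_(_ <= _ < _) _) (x ^+ 3) (x ^+ 2) => a b y z.
move: (6 * _ - _) => c0; rewrite mulNr; lra.
Qed.

(** Only [j <= m/2] is kept, the range in which [term_lower] applies. The loss is
    [x^2 / 90 + (1607 + 1) x^3], and [1/90 + 1608 / 250^2 < 37/1000]. *)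
Lemma sum_term_ge :
  1 - 37 / 1000 * x ^+ 2 <=
    \sum_(1 <= j < m./2.+1) moser_term R m j (critical_exponent R m).
Proof.
have [x0 x1] := modulus_inv_bounds; have m5 := modulus_ge.
have x3 : 0 < x ^+ 3 by apply: exprn_gt0.
have x2 : 0 < x ^+ 2 by apply: exprn_gt0.
set n := m./2.
have S1 : \sum_(1 <= j < n.+1) (1 + second_order R (ln 2) x j%:R) / 2 ^+ j
    - (\sum_(1 <= j < n.+1)
        (j%:R ^+ 4 / 2 + j%:R ^+ 5 / 3 + j%:R ^+ 6 / 8) / 2 ^+ j) * x ^+ 3
    <= \sum_(1 <= j < n.+1) moser_term R m j (critical_exponent R m).
  rewrite mulr_suml -sumrB; apply: ler_sum_nat => j /andP[j0 jn].
  have -> : forall a b c d : R, a / d - b / d * c = (a - b * c) / d.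
    by move=> a b c d; rewrite mulrBl mulrAC.
  apply: term_lower => //; first by apply: leq_trans m5.
  by move: jn; rewrite ltnS /n => jn; lia.
have S2 := @sum_lower_error R n.
have := sum_second_order_modulus n.
have -> : (5000 <= n)%N by rewrite /n geq_half_double.
have -> : (m <= 4 * n)%N.
  by have : (1 < m)%N; [apply: leq_trans m5 | rewrite /n; clear; lia].
move=> /(_ isT isT); rewrite ler_norml => /andP[S3 _].
have S4 := ler_wpM2r (ltW x3) S2.
have /andP[c _] := second_coefficient R.
have S5 := ler_wpM2r (ltW x2) c.
have S6 : 250 * x ^+ 3 <= 1 / 250 * x ^+ 2.
  rewrite mul1r (_ : 250 * x ^+ 3 = 250 * x * x ^+ 2); last by clear; ring.
  exact (ler_wpM2r (ltW x2) x1).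
apply: le_trans S1.
move: S3 S4 S5 S6 x2 x3; clear.
move: (\sum_(_ <= _ < _) _) (\sum_(_ <= _ < _) _) (x ^+ 3) (x ^+ 2) => a b y z.
move: (6 * _ - _) => c0; rewrite mulNr; lra.
Qed.

End LargeModulus.

(** * Localization of the exponent by monotonicity *)

Lemma ln1B_le_lin (R : realType) (y : R) : y < 1 -> ln (1 - y) <= - y.
Proof.
move=> y1; have h : 0 < 1 - y by lra.
by have := expR_ge1Dx (ln (1 - y)); rewrite lnK ?posrE //; lra.
Qed.

Lemma term_le (R : realType) (m j : nat) (K K' : R) : (j < m)%N ->
  K <= K' -> moser_term R m j K' <= moser_term R m j K.
Proof.
move=> jm KK; have M0 : 0 < (m%:R : R) by rewrite ltr0n; apply: leq_ltn_trans jm.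
rewrite /moser_term ler_expR ler_wnM2r //.
apply: le_trans (ln1B_le_lin _ _ _) _; first by rewrite ltr_pdivrMr // mul1r ltr_nat.
by rewrite oppr_le0 divr_ge0.
Qed.

Lemma critical_exponent_gt (R : realType) (m k : nat) : (2 ^ 16 < m)%N ->
  (\sum_(1 <= i < m) i ^ k = m ^ k)%N -> (k%:R : R) < critical_exponent R m.
Proof.
move=> m16 hmk; rewrite ltNge; apply/negP => kle.
have m0 : (0 < m)%N by apply: leq_ltn_trans m16.
have := sum_term_lt1 R m m16; rewrite ltNge => /negP; apply.
rewrite -(sum_term_eq1 R m k m0 hmk).
by apply: ler_sum_nat => j /andP[_ jm]; apply: term_le.
Qed.

Lemma term1_ge (R : realType) (m : nat) : (2 ^ 16 < m)%N ->
  49 / 100 <= moser_term R m 1 (critical_exponent R m).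
Proof.
move=> m16; have [x0 x1] := modulus_inv_bounds R m m16.
have m5 := modulus_ge m m16.
apply: le_trans (@term_lower R m 1 _ isT _); try by apply: leq_trans m5.
move: (m%:R^-1) x0 x1 => x x0 x1; have := ln2_ge0_le R; move: (ln 2) => L /andP[L0 _].
rewrite /second_order !expr1n expr1.
have x2 : 0 <= x ^+ 2 by apply: exprn_ge0; lra.
have x3 : x ^+ 3 <= 1 / 100 by rewrite exprS; nra.
have Lx : 0 <= L * x by apply: mulr_ge0 => //; lra.
have Lx2 : 0 <= L * x ^+ 2 by apply: mulr_ge0.
have LLx2 : 0 <= L ^+ 2 * x ^+ 2 by apply: mulr_ge0 => //; apply: exprn_ge0.
lra.
Qed.

(** Let [x = 1/m] and let [d >= x/8] be the subtracted quantity. If [k] were at most the critical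
    exponent minus [d], the term [j = 1] alone would grow by the factor [(1 - x)^(-d) >= 1 + d x],
    hence by at least [0.49 x^2 / 8 > 0.06 x^2]. This beats the deficit [0.037 x^2] of
    [sum_term_ge], so the sum would exceed 1. *)
Lemma critical_exponent_lt (R : realType) (m k : nat) : (2 ^ 16 < m)%N ->
  (\sum_(1 <= i < m) i ^ k = m ^ k)%N ->
  critical_exponent R m - (4 * (2 * m%:R - 3))^-1 < (k%:R : R).
Proof.
move=> m16 hmk; rewrite ltNge; apply/negP => kle.
have m0 : (0 < m)%N by apply: leq_ltn_trans m16.
have m5 := modulus_ge m m16.
have [x0 x1] := modulus_inv_bounds R m m16.
have S := sum_term_eq1 R m k m0 hmk.
have M5 : 5000 <= (m%:R : R).
  by rewrite ler_nat; apply: leq_trans m5.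
set d := (4 * (2 * m%:R - 3))^-1 in kle.
have d8 : m%:R^-1 / 8 <= d.
  rewrite /d -invfM lef_pV2 ?posrE; [by clear; lra|by clear - M5; lra|].
  by clear - M5; lra.
have d0 : 0 < d by apply: lt_le_trans d8; rewrite divr_gt0.
have T1 :
    moser_term R m 1 (critical_exponent R m) * (1 + d * m%:R^-1) <= moser_term R m 1 k%:R.
  have h1 : (1 < m)%N by apply: leq_trans m5.
  apply: le_trans (term_le _ _ _ _ _ h1 kle).
  rewrite /moser_term mulrBl expRD ler_wpM2l ?expR_ge0 //.
  apply: le_trans (expR_ge1Dx _); rewrite lerD2l -mulrN ler_wpM2l ?(ltW d0) //.
  rewrite lerNr mul1r; apply: ln1B_le_lin; clear - x0 x1; lra.
have n0 : (0 < m./2)%N by rewrite geq_half_double; apply: leq_trans m5.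
have : \sum_(1 <= j < m./2.+1) moser_term R m j (critical_exponent R m)
    + moser_term R m 1 (critical_exponent R m) * (d * m%:R^-1)
    <= \sum_(1 <= j < m) moser_term R m j k%:R.
  have nm : (m./2.+1 <= m)%N by move: m0; clear; lia.
  rewrite [X in _ <= X](big_cat_nat (n := m./2.+1)) //=.
  rewrite -[X in X <= _]addr0; apply: lerD; last first.
    by apply: sumr_ge0 => j _; apply: expR_ge0.
  rewrite big_ltn // [X in _ <= X]big_ltn // addrAC; apply: lerD.
    by rewrite -{1}[moser_term _ _ _ _]mulr1 -mulrDr.
  apply: ler_sum_nat => j /andP[_ jm]; apply: term_le; first by move: jm m0; clear; lia.
  by apply: le_trans kle _; clear - d0; lra.
rewrite S; apply/negP; rewrite -ltNge.
have := sum_term_ge R m m16; have T := term1_ge R m m16.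
have : 49 / 100 * (m%:R^-1 / 8 * m%:R^-1)
    <= moser_term R m 1 (critical_exponent R m) * (d * m%:R^-1).
  apply: ler_pM; [by clear; lra|by apply: mulr_ge0; clear - x0; lra|exact: T|].
  by apply: ler_wpM2r => //; apply: ltW.
have x2 : 0 < (m%:R^-1 : R) ^+ 2 by apply: exprn_gt0.
move: x2; clear; move: (m%:R^-1) => x.
move: (moser_term _ _ _ _ * _) (\sum_(_ <= _ < _) _) => a b; lra.
Qed.

(** * Conclusion by Legendre's criterion *)

Lemma dvdz_leq_pos (a b : int) : 0 < b -> (a %| b)%Z -> a <= b.
Proof.
move=> b0 /dvdzP[c bE]; have [a0|a0] := lerP a 0; first by lia.
by have [c0|c0] := lerP c 0; nia.
Qed.

Theorem corollary1 (R : realType) (m k : nat) (hm : (0 < m)%N) (hk : (2 <= k)%N)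
  (hmk : (\sum_(1 <= i < m) i ^ k = m ^ k)%N) :
  exists j : nat, ~~ odd j /\
    is_convergent (ln (2 : R)) j ((2 * k%:R) / (2 * m%:R - 3) : rat).
Proof.
have m16 := erdos_moser_gt m k (ltnW hk) hmk hm hk.
have m5 := modulus_ge m m16.
have lt := critical_exponent_gt R m k m16 hmk.
have gt := critical_exponent_lt R m k m16 hmk.
have M5 : 5000 <= (m%:R : R) by rewrite ler_nat; apply: leq_trans m5.
set d : int := 2 * m%:Z - 3; set p : int := 2 * k%:Z.
have d0 : 0 < d.
  by have : (2 < m)%N; [apply: leq_trans m5|rewrite /d; clear; lia].
have -> : (2 * k%:R) / (2 * m%:R - 3) = p%:~R / d%:~R :> rat.
  by rewrite /p /d intrB !intrM.
have dE : (d%:~R : R) = 2 * m%:R - 3 by rewrite /d intrB intrM.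
have rE : ratr (p%:~R / d%:~R) = 2 * k%:R / (2 * m%:R - 3) :> R.
  by rewrite fmorph_div /= !ratr_int dE /p intrM.
have D0 : 0 < 2 * (m%:R : R) - 3 by clear - M5; lra.
apply: (@legendre_even_convergent R _ _ d) => //.
- have d1 : (d%:~R : rat) != 0 by rewrite intr_eq0 gt_eqF.
  (* The reduced denominator divides [d]: it divides [numq * d = p * denq] and is coprime to
     [numq]. *)
  apply: dvdz_leq_pos => //; rewrite -(Gauss_dvdzr _ (n := numq (p%:~R / d%:~R))).
    apply/dvdzP; exists p; apply: (@intr_inj rat).
    by rewrite !intrM numqE mulrAC mulfVK.
  by rewrite coprimezE coprime_sym coprime_num_den.
- rewrite rE ltr_pdivrMr //; move: lt; rewrite /critical_exponent; clear; lra.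
- rewrite rE dE; move: lt gt D0; rewrite /critical_exponent; clear.
  set D := 2 * m%:R - 3 => lt gt D0.
  have -> : (ln 2 - 2 * k%:R / D) * (2 * D ^+ 2) = 2 * D * (ln 2 * D - 2 * k%:R).
    by field; rewrite gt_eqF.
  (* The critical exponent is [ln 2 * D / 2], so doubling the lower bound on [k] gives
     [ln 2 * D - 2 k < 1 / (2 D)]. *)
  have : 2 * D * (ln 2 * D - 2 * k%:R) <= 2 * D * (2 * D)^-1.
    apply: ler_wpM2l; first by lra.
    have -> : (2 * D)^-1 = 2 * (4 * D)^-1 by field; rewrite gt_eqF.
    by move: gt; rewrite /D; move: ((4 * _)^-1) => i; lra.
  by rewrite mulfV // gt_eqF //; lra.
Qed.
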